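(* For all positive integers $m,n,j,k,s,t$, the product $$\zeta(m+1,\{1\}^{j-1})\,\zeta(n+1,\{1\}^{k-1},s+1,\{1\}^{t-1})$$ equals $\Sigma_1+\Sigma_2+\Sigma_3+\Sigma_4$, where $$ \begin{aligned} \Sigma_1=&\sum_{\substack{0\le n_1\le n\\ j_1+j_2+j_3+j_4=j\\ |\alpha|=n-n_1+j_1+1\\ |\tilde\alpha|=s+j_3}}\binom{m-1+n_1}{m-1}\binom{j_2+k-1}{k-1}\binom{j_4+t-1}{t-1}\\ &\quad\times\zeta\big(\alpha_1+m+n_1,\alpha_2,\ldots,\alpha_{j_1},\alpha_{j_1+1},\{1\}^{j_2+k-1},\tilde\alpha_1+1,\tilde\alpha_2,\ldots,\tilde\alpha_{j_3},\tilde\alpha_{j_3+1},\{1\}^{j_4+t-1}\big), \end{aligned} $$ $$ \begin{aligned} \Sigma_2=&\sum_{\substack{1\le k_1\le k\\ 0\le m_1\le m-1}}\binom{m_1+n-1}{n-1}\sum_{\substack{j_1+j_2+j_3=j\\ |\beta|=m-m_1+k_1\\ |\tilde\beta|=s+j_2}}\binom{j_1+k-k_1}{k-k_1}\binom{j_3+t-1}{t-1}\\ &\quad\times\zeta\big(\beta_1+m_1+n,\beta_2,\ldots,\beta_{k_1},\beta_{k_1+1}+1,\{1\}^{j_1+k-k_1-1},\tilde\beta_1+1,\tilde\beta_2,\ldots,\tilde\beta_{j_2},\tilde\beta_{j_2+1},\{1\}^{j_3+t-1}\big), \end{aligned} $$ with the convention that when $j_1+k-k_1=0$ (that is, $j_1=0$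 and $k_1=k$) the block $\beta_{k_1+1}+1,\{1\}^{j_1+k-k_1-1},\tilde\beta_1+1$ is read as the single entry $\beta_{k_1+1}+\tilde\beta_1+1$, $$ \begin{aligned} \Sigma_3=&\sum_{\substack{1\le s_1\le s\\ m_1+m_2+m_3=m-1}}\binom{m_1+n-1}{n-1}\binom{m_3+s_1-1}{s_1-1}\sum_{\substack{j_1+j_2=j\\ |\gamma|=m_2+k+1\\ |\tilde\gamma|=s-s_1+j_1+1}}\binom{j_2+t-1}{t-1}\\ &\quad\times\zeta\big(\gamma_1+m_1+n,\gamma_2,\ldots,\gamma_k,\gamma_{k+1}+\tilde\gamma_1+m_3+s_1,\tilde\gamma_2,\ldots,\tilde\gamma_{j_1},\tilde\gamma_{j_1+1},\{1\}^{j_2+t-1}\big), \end{aligned} $$ $$ \begin{aligned} \Sigma_4=&\sum_{\substack{1\le t_1\le t\\ m_1+m_2+m_3+m_4=m-1}}\binom{m_1+n-1}{n-1}\binom{m_3+s-1}{s-1}\binom{j+t-t_1}{j}\\ &\quad\times\sum_{\substack{|\delta|=m_2+k\\ |\tilde\delta|=m_4+t_1+1}}\zeta\big(\delta_1+m_1+n,\delta_2,\ldots,\delta_k,m_3+s+\tilde\delta_1,\tilde\delta_2,\ldots,\tilde\delta_{t_1},\tilde\delta_{t_1+1}+1,\{1\}^{j+t-t_1-1}\big). \end{aligned} $$ Here all $j_i$ and $m_i$ range over integers $\ge 0$ subject to the indicated constraints, and the Greek tuples range over all tuples of integers $\ge 1$ of the following lengths with the indicated sums of entries: $\alpha=(\alpha_1,\ldots,\alpha_{j_1+1})$,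 $\tilde\alpha=(\tilde\alpha_1,\ldots,\tilde\alpha_{j_3+1})$, $\beta=(\beta_1,\ldots,\beta_{k_1+1})$, $\tilde\beta=(\tilde\beta_1,\ldots,\tilde\beta_{j_2+1})$, $\gamma=(\gamma_1,\ldots,\gamma_{k+1})$, $\tilde\gamma=(\tilde\gamma_1,\ldots,\tilde\gamma_{j_1+1})$, $\delta=(\delta_1,\ldots,\delta_k)$, $\tilde\delta=(\tilde\delta_1,\ldots,\tilde\delta_{t_1+1})$, where $|\cdot|$ denotes the sum of the entries of a tuple.
   Context: For positive integers $s_1,\ldots,s_r$ with $s_1\ge 2$, the multiple zeta value is the real number $$\zeta(s_1,\ldots,s_r)=\sum_{n_1>n_2>\cdots>n_r\ge 1}\frac{1}{n_1^{s_1}\cdots n_r^{s_r}}.$$ $\{1\}^p$ denotes the string $1,\ldots,1$ with $p$ terms (the empty string if $p=0$). Convention for short strings: a displayed string of entries indexed by a tuple of length $\ell$ contains exactly one entry for each index $1,\ldots,\ell$, the first (and, where shown, last) entry carrying the displayed shift. For example, when $j_1=0$ the string $\alpha_1+m+n_1,\alpha_2,\ldots,\alpha_{j_1},\alpha_{j_1+1}$ is the single entry $\alpha_1+m+n_1$; when $j_3=0$ (resp. $j_2=0$) the string $\tilde\alpha_1+1,\ldots,\tilde\alpha_{j_3+1}$ (resp. $\tilde\beta_1+1,\ldots,\tilde\beta_{j_2+1}$) is the single entry $\tilde\alpha_1+1$ (resp. $\tilde\beta_1+1$); when $j_1=0$ in $\Sigma_3$ the string $\tilde\gamma_2,\ldots,\tilde\gamma_{j_1+1}$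 is empty; when $k=1$ the string $\delta_1+m_1+n,\delta_2,\ldots,\delta_k$ is the single entry $\delta_1+m_1+n$. *)

(* Defs.v *)
From mathcomp Require Import all_boot all_order all_algebra.
From mathcomp Require Import all_classical all_reals all_analysis.
Set Implicit Arguments.
Unset Strict Implicit.
Unset Printing Implicit Defensive.
Import Order.TTheory GRing.Theory Num.Theory.
Local Open Scope ring_scope.

(* The index tuples n_1 > ... > n_r >= 1. *)
Definition mzv_index (r : nat) : set (seq nat) :=
  [set u : seq nat |
    [/\ size u = r, sorted (fun a b => (b < a)%N) u & all (leq 1) u]]%classic.

(* The sum of nonnegative terms is taken in \bar R; [fine] sends a divergent
   sum to 0, so this is the multiple zeta value only when the first entry of s
   is at least 2 (and the other entries are positive). *)
Definition mzv (R : realType) (s : seq nat) : R :=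
  fine (\esum_(u in mzv_index (size s))
    (\prod_(i < size s) ((nth 0%N u i)%:R ^- nth 0%N s i))%:E).

(* All l-tuples of integers >= 1 with sum w, each listed once. *)
Definition compositions (l w : nat) : seq (seq nat) :=
  [seq a <- [seq [seq val i | i <- t] | t : l.-tuple 'I_w.+1]
          | all (leq 1) a && (sumn a == w)].

(* Positions are counted from 0: [add_at 0 c a] shifts the first entry. *)
Definition add_at (i c : nat) (a : seq nat) : seq nat :=
  set_nth 0%N a i (nth 0%N a i + c)%N.

Definition ones (p : nat) : seq nat := nseq p 1%N.

(* The string x_1, ..., x_i, x_(i+1) + y_1 + c, y_2, y_3, ... for x of
   length i + 1. *)
Definition glue (i c : nat) (x y : seq nat) : seq nat :=
  take i x ++ (nth 0 x i + head 0 y + c)%N :: behead y.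

Definition Sigma1 (R : realType) (m n j k s t : nat) : R :=
  \sum_(0 <= n1 < n.+1)
  \sum_(0 <= j1 < j.+1) \sum_(0 <= j2 < j.+1)
  \sum_(0 <= j3 < j.+1) \sum_(0 <= j4 < j.+1 | (j1 + j2 + j3 + j4 == j)%N)
  \sum_(a <- compositions j1.+1 (n - n1 + j1 + 1))
  \sum_(a' <- compositions j3.+1 (s + j3))
    ('C(m - 1 + n1, m - 1) * 'C(j2 + k - 1, k - 1) * 'C(j4 + t - 1, t - 1))%:R
    * mzv R (add_at 0 (m + n1) a ++ ones (j2 + k - 1)
             ++ add_at 0 1 a' ++ ones (j4 + t - 1)).

(* The middle block of the string in [Sigma2]; when j1 + k - k1 = 0, the
   entries b_(k1+1) + 1 and b'_1 + 1, separated by "-1 ones", are read as the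
   single entry b_(k1+1) + b'_1 + 1. *)
Definition Sigma2_string (m1 n k k1 j1 : nat) (b b' : seq nat) : seq nat :=
  if (j1 + k - k1 == 0)%N then glue k1 1 (add_at 0 (m1 + n) b) b'
  else add_at k1 1 (add_at 0 (m1 + n) b) ++ ones (j1 + k - k1 - 1)
       ++ add_at 0 1 b'.

Definition Sigma2 (R : realType) (m n j k s t : nat) : R :=
  \sum_(1 <= k1 < k.+1) \sum_(0 <= m1 < m)
    'C(m1 + n - 1, n - 1)%:R *
  \sum_(0 <= j1 < j.+1) \sum_(0 <= j2 < j.+1)
  \sum_(0 <= j3 < j.+1 | (j1 + j2 + j3 == j)%N)
  \sum_(b <- compositions k1.+1 (m - m1 + k1))
  \sum_(b' <- compositions j2.+1 (s + j2))
    ('C(j1 + k - k1, k - k1) * 'C(j3 + t - 1, t - 1))%:R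
    * mzv R (Sigma2_string m1 n k k1 j1 b b' ++ ones (j3 + t - 1)).

Definition Sigma3 (R : realType) (m n j k s t : nat) : R :=
  \sum_(1 <= s1 < s.+1)
  \sum_(0 <= m1 < m) \sum_(0 <= m2 < m)
  \sum_(0 <= m3 < m | (m1 + m2 + m3 == m - 1)%N)
    ('C(m1 + n - 1, n - 1) * 'C(m3 + s1 - 1, s1 - 1))%:R *
  \sum_(0 <= j1 < j.+1) \sum_(0 <= j2 < j.+1 | (j1 + j2 == j)%N)
  \sum_(g <- compositions k.+1 (m2 + k + 1))
  \sum_(g' <- compositions j1.+1 (s - s1 + j1 + 1))
    'C(j2 + t - 1, t - 1)%:R
    * mzv R (glue k (m3 + s1) (add_at 0 (m1 + n) g) g' ++ ones (j2 + t - 1)).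

Definition Sigma4 (R : realType) (m n j k s t : nat) : R :=
  \sum_(1 <= t1 < t.+1)
  \sum_(0 <= m1 < m) \sum_(0 <= m2 < m)
  \sum_(0 <= m3 < m) \sum_(0 <= m4 < m | (m1 + m2 + m3 + m4 == m - 1)%N)
    ('C(m1 + n - 1, n - 1) * 'C(m3 + s - 1, s - 1) * 'C(j + t - t1, j))%:R *
  \sum_(d <- compositions k (m2 + k))
  \sum_(d' <- compositions t1.+1 (m4 + t1 + 1))
    mzv R (add_at 0 (m1 + n) d ++ add_at t1 1 (add_at 0 (m3 + s) d')
           ++ ones (j + t - t1 - 1)).

(* Main.v *)
(* Read a multiple zeta value as a word in x_0 = dt/t and x_1 = dt/(1-t), so
   that the two factors are x_0^m x_1^j and x_0^n x_1^k x_0^s x_1^t.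

   The product of two values is the sum over the shuffles of their words: in
   terms of the coefficients of multiple polylogarithms as power series in z,
   z d/dz removes the first letter x_0, removes x_1 up to the factor z/(1-z),
   and is a derivation for the Cauchy product.

   Each shuffle is then classified by the number of letters of the second word
   that precede the last x_0 of x_0^m; this number lies in one of the four runs
   x_0^n, x_1^k, x_0^s, x_1^t, whence the four sums. Marking in the same way one
   letter at each change of run reduces everything to shuffles of two constant
   words: equal letters give a binomial coefficient, distinct letters give the
   words enumerated by compositions. *)

Require Import Defs.
From mathcomp Require Import all_boot all_order all_algebra.
From mathcomp Require Import all_classical all_reals all_analysis.
From mathcomp Require Import zify ring lra.
Set Implicit Arguments.
Unset Strict Implicit.
Unset Printing Implicit Defensive.
Import Order.TTheory GRing.Theory Num.Theory.
Import numFieldNormedType.Exports.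
Local Open Scope ring_scope.

(** * Shuffles *)

Section ShuffleSum.
Variables (A : Type) (V : nmodType).
Implicit Types (u v p q w : seq A) (F G : seq A -> V).

(** Shuffles count with multiplicity. The letters already chosen are absorbed into the continuation
    [F], so no list of shuffles is built; the inner fixpoint is there because a step may shorten
    either word. *)
Fixpoint shuffle_sum u : seq A -> (seq A -> V) -> V :=
  fix aux v F := match u, v with
    | [::], _ => F v
    | _, [::] => F u
    | x :: u', y :: v' =>
        shuffle_sum u' v (fun w => F (x :: w)) + aux v' (fun w => F (y :: w))
    end.

Lemma shuffle_sum0s v F : shuffle_sum [::] v F = F v.
Proof. by case: v. Qed.

Lemma shuffle_sums0 u F : shuffle_sum u [::] F = F u.
Proof. by case: u. Qed.

Lemma shuffle_sum_cons x u y v F :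
  shuffle_sum (x :: u) (y :: v) F =
  shuffle_sum u (y :: v) (fun w => F (x :: w))
  + shuffle_sum (x :: u) v (fun w => F (y :: w)).
Proof. by []. Qed.

Lemma eq_shuffle_sum u v F G : F =1 G -> shuffle_sum u v F = shuffle_sum u v G.
Proof.
elim: u v F G => [|x u IHu] v F G eqFG; first by rewrite !shuffle_sum0s.
elim: v F G eqFG => [|y v IHv] F G eqFG; first by rewrite !shuffle_sums0.
rewrite !shuffle_sum_cons; congr (_ + _); first exact: IHu.
exact: IHv.
Qed.

Lemma shuffle_sumC u v F : shuffle_sum u v F = shuffle_sum v u F.
Proof.
elim: u v F => [|x u IHu] v F; first by rewrite shuffle_sum0s shuffle_sums0.
elim: v F => [|y v IHv] F; first by rewrite shuffle_sum0s shuffle_sums0.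
by rewrite !shuffle_sum_cons IHu IHv addrC.
Qed.

Lemma shuffle_sumD u v F G :
  shuffle_sum u v (fun w => F w + G w) = shuffle_sum u v F + shuffle_sum u v G.
Proof.
elim: u v F G => [|x u IHu] v F G; first by rewrite !shuffle_sum0s.
elim: v F G => [|y v IHv] F G; first by rewrite !shuffle_sums0.
by rewrite !shuffle_sum_cons IHu IHv addrACA.
Qed.

(* Shuffles are classified by the number of letters of u placed before the
   marked letter a. *)
Lemma shuffle_sum_cat_cons u p a q F :
  shuffle_sum u (p ++ a :: q) F =
  \sum_(0 <= i < (size u).+1)
    shuffle_sum (take i u) p
      (fun w => shuffle_sum (drop i u) q (fun w' => F (w ++ a :: w'))).
Proof.
elim: u p F => [|x u IHu] p F.
  by rewrite big_nat1 !shuffle_sum0s.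
elim: p F => [|b p IHp] F.
  rewrite cat0s shuffle_sum_cons -[a :: q]cat0s IHu addrC.
  rewrite [in RHS]big_nat_recl//=.
  congr (_ + _); apply: eq_big_nat => i _.
  by rewrite !shuffle_sums0.
rewrite cat_cons shuffle_sum_cons -cat_cons IHu IHp.
rewrite [in RHS]big_nat_recl// [in X in _ + X]big_nat_recl//.
rewrite !take0 !drop0 !shuffle_sum0s addrCA -big_split/=.
by [].
Qed.

Lemma shuffle_sum_nseq_cat_cons c x p a q F :
  shuffle_sum (nseq c x) (p ++ a :: q) F =
  \sum_(0 <= i < c.+1)
    shuffle_sum (nseq i x) p
      (fun w => shuffle_sum (nseq (c - i) x) q (fun w' => F (w ++ a :: w'))).
Proof.
rewrite shuffle_sum_cat_cons size_nseq; apply: eq_big_nat => i /andP[_ ic].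
by rewrite take_nseq// drop_nseq.
Qed.

(** All shuffles are the same word. Both branches of the recursion put [x] in front, so the
    multiplicity obeys Pascal's rule. *)
Lemma shuffle_sum_nseq a b x F :
  shuffle_sum (nseq a x) (nseq b x) F = F (nseq (a + b) x) *+ 'C(a + b, b).
Proof.
elim: a b F => [|a IHa] b F; first by rewrite shuffle_sum0s binn mulr1n.
elim: b F => [|b IHb] F; first by rewrite shuffle_sums0 addn0 bin0 mulr1n.
rewrite (_ : shuffle_sum _ _ _ =
  shuffle_sum (nseq a x) (nseq b.+1 x) (fun w => F (x :: w))
  + shuffle_sum (nseq a.+1 x) (nseq b x) (fun w => F (x :: w)))//.
by rewrite IHa IHb !addSn !addnS -mulrnDr -binS.
Qed.

End ShuffleSum.



(** * Nested sums over indices with a prescribed total *)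

Section Simplex.
Variables (V : nmodType).

Lemma big_nat_addn_eq B e j (H : nat -> V) : (j < B)%N ->
  \sum_(0 <= d < B | (e + d == j)%N) H d = if (e <= j)%N then H (j - e)%N else 0.
Proof.
move=> jB; case: leqP => ej.
  rewrite (eq_bigl (fun d => d == j - e)%N) => [|d]; last by apply/eqP/eqP; lia.
  by rewrite big_nat1_eq leq0n/= (leq_ltn_trans (leq_subr _ _) jB).
by rewrite big1// => d /eqP; lia.
Qed.

Lemma big_nat_addn_le B e j (H : nat -> V) : (j < B)%N ->
  \sum_(0 <= c < B) (if (e + c <= j)%N then H c else 0) =
  if (e <= j)%N then \sum_(0 <= c < (j - e).+1) H c else 0.
Proof.
move=> jB; rewrite -big_mkcond; case: leqP => ej; last first.
  by rewrite big1// => d; lia.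
rewrite [RHS](@big_nat_widen _ _ _ _ _ B); last by lia.
by apply: eq_bigl => c /=; apply/idP/idP; lia.
Qed.

(** In [Sigma1] to [Sigma4] all indices have the same range and a condition on the last one fixes
    the total. Shuffling yields instead ranges cut down by the preceding indices, the last index
    being determined. This lemma and the next two translate. *)
Lemma big_nat_simplex2 j (H : nat -> nat -> V) :
  \sum_(0 <= a < j.+1) \sum_(0 <= b < j.+1 | (a + b == j)%N) H a b =
  \sum_(0 <= a < j.+1) H a (j - a)%N.
Proof.
apply: eq_big_nat => a /andP[_ aj].
by rewrite big_nat_addn_eq// -ltnS aj.
Qed.

Lemma big_nat_simplex3 j (H : nat -> nat -> nat -> V) :
  \sum_(0 <= a < j.+1) \sum_(0 <= b < j.+1)
    \sum_(0 <= c < j.+1 | (a + b + c == j)%N) H a b c =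
  \sum_(0 <= a < j.+1) \sum_(0 <= b < (j - a).+1) H a b (j - a - b)%N.
Proof.
apply: eq_big_nat => a /andP[_ aj].
under eq_bigr do rewrite big_nat_addn_eq// subnDA.
by rewrite big_nat_addn_le// -ltnS aj.
Qed.

Lemma big_nat_simplex4 j (H : nat -> nat -> nat -> nat -> V) :
  \sum_(0 <= a < j.+1) \sum_(0 <= b < j.+1) \sum_(0 <= c < j.+1)
    \sum_(0 <= d < j.+1 | (a + b + c + d == j)%N) H a b c d =
  \sum_(0 <= a < j.+1) \sum_(0 <= b < (j - a).+1)
    \sum_(0 <= c < (j - a - b).+1) H a b c (j - a - b - c)%N.
Proof.
apply: eq_big_nat => a /andP[_ aj].
under eq_bigr => b _.
  under eq_bigr do rewrite big_nat_addn_eq// subnDA subnDA.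
  rewrite big_nat_addn_le// subnDA.
  over.
by rewrite big_nat_addn_le// -ltnS aj.
Qed.

End Simplex.

(** * Sums over compositions *)

Section Compositions.

Lemma mem_compositions l w (a : seq nat) :
  (a \in compositions l w) = [&& size a == l, all (leq 1) a & sumn a == w].
Proof.
rewrite mem_filter andbC andbA [RHS]andbA.
apply/idP/idP => [/andP[/andP[/mapP[t _ ->] ->] ->]|].
  by rewrite size_map size_tuple eqxx.
move=> /andP[/andP[/eqP sa a1] /eqP wa]; rewrite a1 wa eqxx !andbT.
(* No entry exceeds the sum, so every such list comes from a tuple over ['I_w.+1]. *)
have aw x : x \in a -> (x < w.+1)%N.
  rewrite ltnS -wa; elim: a {sa a1 wa} => //= y a IHa.
  by rewrite inE => /orP[/eqP ->|/IHa]; lia.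
have st : size (map (@inord w) a) == l by rewrite size_map sa.
apply/mapP; exists (Tuple st); first by rewrite mem_enum.
rewrite -map_comp map_id_in// => x xa /=.
by rewrite inordK// aw.
Qed.

Lemma compositions_uniq l w : uniq (compositions l w).
Proof.
apply: filter_uniq; rewrite map_inj_uniq ?enum_uniq//.
by move=> x y /(inj_map val_inj)/val_inj.
Qed.

Variable V : nmodType.

Lemma big_compositions1 w (G : seq nat -> V) :
  \sum_(a <- compositions 1 w.+1) G a = G [:: w.+1].
Proof.
rewrite -[RHS](big_seq1 +%R _ G); apply: perm_big.
apply: uniq_perm; rewrite ?compositions_uniq// => -[|x [|y a]];
  rewrite mem_compositions ?inE//= eqseq_cons.
  by rewrite andbT addn0 andbT; case: eqP => [->|]; rewrite ?andbF.
by rewrite andbF.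
Qed.

Lemma big_compositionsS l w (G : seq nat -> V) :
  \sum_(a <- compositions l.+1 w.+1) G a =
  \sum_(0 <= i < w.+1) \sum_(a <- compositions l (w - i)) G (i.+1 :: a).
Proof.
rewrite -(@big_allpairs_dep _ _ _ _ _ _ (fun i a => i.+1 :: a)).
apply: perm_big; apply: uniq_perm; first exact: compositions_uniq.
  apply: allpairs_uniq_dep; [exact: iota_uniq| |].
    by move=> *; exact: compositions_uniq.
  by move=> [i a] [i' a'] _ _ [/= -> ->].
move=> a; apply/idP/allpairsPdep => [|[i [b [+ + ->]]]]; last first.
  rewrite mem_index_iota !mem_compositions/= => iw /and3P[/eqP-> -> /eqP->].
  by rewrite eqxx/= addSn eqSS; apply/eqP; lia.
rewrite mem_compositions; case: a => [|[|i] a]//=; first by rewrite andbF.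
move=> /and3P[/eqP[sa] a1 /eqP[aw]].
exists i, a; rewrite mem_index_iota mem_compositions sa a1 eqxx/=; split => //.
  by lia.
by apply/eqP; lia.
Qed.

End Compositions.

(** * Words and compositions *)

(* false and true are the letters x_0 = dt/t and x_1 = dt/(1-t). *)
Fixpoint exponents (c : nat) (w : seq bool) : seq nat :=
  match w with
  | [::] => [::]
  | false :: w' => exponents c.+1 w'
  | true :: w' => c.+1 :: exponents 0 w'
  end.

(* x_0^(a_1 - 1) x_1 ... x_1 x_0^(a_r - 1), without the final x_1. *)
Fixpoint open_word (a : seq nat) : seq bool :=
  match a with
  | [::] => [::]
  | [:: x] => nseq x.-1 false
  | x :: a' => nseq x.-1 false ++ true :: open_word a'
  end.

Arguments open_word : simpl never.

Lemma open_word_cons x a : a != [::] ->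
  open_word (x :: a) = nseq x.-1 false ++ true :: open_word a.
Proof. by case: a. Qed.

Section Exponents.
Implicit Types (w : seq bool) (a : seq nat).

Lemma exponents_nseq_false c i w :
  exponents c (nseq i false ++ w) = exponents (c + i) w.
Proof. by elim: i c => [|i IHi] c /=; rewrite ?addn0// IHi addSnnS. Qed.

Lemma exponents_nseq_true i w :
  exponents 0 (nseq i true ++ w) = ones i ++ exponents 0 w.
Proof. by elim: i => //= i ->. Qed.

Lemma exponents_ones i : exponents 0 (nseq i true) = ones i.
Proof. by rewrite -[nseq i true]cats0 exponents_nseq_true cats0. Qed.

Lemma add_at0 c x a : add_at 0 c (x :: a) = (x + c)%N :: a.
Proof. by []. Qed.

Lemma size_add_at0 l c a : size a = l.+1 -> size (add_at 0 c a) = l.+1.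
Proof. by case: a. Qed.

Lemma add_at0_pos l c a :
  size a = l.+1 -> all (leq 1) a -> all (leq 1) (add_at 0 c a).
Proof. by case: a => [|[|x] a]. Qed.

Lemma nth_add_at0_gt0 l c a :
  size a = l.+1 -> all (leq 1) a -> (0 < nth 0 (add_at 0 c a) l)%N.
Proof.
move=> sa a1; have /(all_nthP 0%N) := add_at0_pos c sa a1; apply.
by rewrite (size_add_at0 c sa).
Qed.

Lemma add_at_last l c a : size a = l.+1 ->
  add_at l c a = rcons (take l a) (nth 0%N a l + c)%N.
Proof.
by move=> sa; rewrite /add_at set_nthE sa ltnSn drop_oversize ?sa// cats1.
Qed.

(** The [c] pending letters x_0 join the first block. No x_1 closes the last block, so its letters
    x_0, one fewer than the entry, become the pending count for [w]. *)
Lemma exponents_open_word l c a w : size a = l.+1 -> all (leq 1) a ->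
  exponents c (open_word a ++ w) =
  take l (add_at 0 c a) ++ exponents (nth 0%N (add_at 0 c a) l).-1 w.
Proof.
elim: l c a => [|l IHl] c [|[|x] a]// [sa] a1.
  by rewrite (size0nil sa) exponents_nseq_false addnC.
rewrite open_word_cons -?size_eq0 ?sa// -catA exponents_nseq_false/= IHl//.
have -> : add_at 0 0 a = a by case: a sa {a1} => // y a _; rewrite add_at0 addn0.
by rewrite addnC.
Qed.

Lemma exponents_open_word_true l c a w : size a = l.+1 -> all (leq 1) a ->
  exponents c (open_word a ++ true :: w) = add_at 0 c a ++ exponents 0 w.
Proof.
move=> sa a1; rewrite (@exponents_open_word l)//= -cat_rcons; congr (_ ++ _).
have sA := size_add_at0 c sa.
rewrite prednK ?(nth_add_at0_gt0 c sa)//.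
by rewrite -take_nth ?sA// -sA take_size.
Qed.

End Exponents.

(** * Shuffles of a constant word with a product of runs *)

Section ShuffleOfRuns.
Variables (R : nzRingType).
Implicit Types (G : seq bool -> R) (q : seq bool).

Lemma big_compositions_lt l w (G : seq nat -> R) : (w < l)%N ->
  \sum_(a <- compositions l w) G a = 0.
Proof.
move=> wl; rewrite big_seq big1// => a; rewrite mem_compositions.
move=> /and3P[/eqP sa a1 /eqP aw]; exfalso.
suff : (size a <= sumn a)%N by rewrite sa aw leqNgt wl.
elim: a {sa aw} a1 => //= x a IHa /andP[x1 /IHa].
by rewrite -add1n; exact: leq_add.
Qed.

(** A shuffle is determined by the numbers of x_0 in the [b.+1] gaps around the letters x_1. Adding
    1 to each number gives a composition of a + b + 1. The induction marks the first x_1. *)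
Lemma shuffle_sum_false_true a b G :
  shuffle_sum (nseq a false) (nseq b true) G =
  \sum_(c <- compositions b.+1 (a + b).+1) G (open_word c).
Proof.
elim: b a G => [|b IHb] a G.
  by rewrite shuffle_sums0 addn0 big_compositions1.
rewrite -[nseq b.+1 true]/([::] ++ true :: nseq b true) shuffle_sum_nseq_cat_cons.
rewrite big_compositionsS [RHS](@big_cat_nat _ _ _ a.+1)//=; last by lia.
(* For i > a the weight left is smaller than the number of entries left. *)
rewrite [X in _ + X]big_nat_cond [X in _ + X]big1 ?addr0; last first.
  by move=> i /andP[/andP[ai _] _]; apply: big_compositions_lt; lia.
apply: eq_big_nat => i /andP[_ ia]; rewrite shuffle_sums0 IHb.
rewrite (_ : (a - i + b).+1 = (a + b.+1 - i)%N); last by lia.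
apply: eq_big_seq => c; rewrite mem_compositions => /and3P[/eqP sc _ _].
by rewrite open_word_cons// -size_eq0 sc.
Qed.

Lemma shuffle_sum_false_true_cat c b y q G :
  shuffle_sum (nseq c false) (nseq b true ++ y :: q) G =
  \sum_(0 <= i < c.+1) \sum_(a <- compositions b.+1 (i + b).+1)
    shuffle_sum (nseq (c - i) false) q (fun w => G (open_word a ++ y :: w)).
Proof.
rewrite shuffle_sum_nseq_cat_cons.
by apply: eq_bigr => i _; rewrite shuffle_sum_false_true.
Qed.

Lemma shuffle_sum_true_false_cat c b y q G :
  shuffle_sum (nseq c true) (nseq b false ++ y :: q) G =
  \sum_(0 <= i < c.+1) \sum_(a <- compositions i.+1 (b + i).+1)
    shuffle_sum (nseq (c - i) true) q (fun w => G (open_word a ++ y :: w)).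
Proof.
rewrite shuffle_sum_nseq_cat_cons.
by apply: eq_bigr => i _; rewrite shuffle_sumC shuffle_sum_false_true.
Qed.

Lemma shuffle_sum_run a b x G :
  shuffle_sum (nseq a x) (nseq b x) G = 'C(a + b, b)%:R * G (nseq (a + b) x).
Proof. by rewrite shuffle_sum_nseq mulr_natl. Qed.

Lemma shuffle_sum_run_cat c b x y q G :
  shuffle_sum (nseq c x) (nseq b x ++ y :: q) G =
  \sum_(0 <= i < c.+1) 'C(i + b, b)%:R *
    shuffle_sum (nseq (c - i) x) q (fun w => G (nseq (i + b) x ++ y :: w)).
Proof.
rewrite shuffle_sum_nseq_cat_cons.
by apply: eq_bigr => i _; rewrite shuffle_sum_run.
Qed.

(** Here and below the digits in the name list the runs of the second word. The letter marked at a
    change of run ends the old run or begins the new one, whichever produces the binomial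
    coefficients and tuple lengths of the target sum. *)
Lemma shuffle_sum_true_01 j b t G :
  shuffle_sum (nseq j true) (nseq b false ++ true :: nseq t true) G =
  \sum_(0 <= j1 < j.+1) \sum_(a <- compositions j1.+1 (b + j1).+1)
    'C(j - j1 + t, t)%:R
    * G (open_word a ++ true :: nseq (j - j1 + t) true).
Proof.
rewrite shuffle_sum_true_false_cat; apply: eq_bigr => j1 _.
by apply: eq_bigr => a _; rewrite shuffle_sum_run.
Qed.

Lemma shuffle_sum_true_101 j a b t G :
  shuffle_sum (nseq j true)
    (nseq a true ++ false :: nseq b false ++ true :: nseq t true) G =
  \sum_(0 <= j1 < j.+1) 'C(j1 + a, a)%:R *
  \sum_(0 <= j2 < (j - j1).+1) \sum_(c <- compositions j2.+1 (b + j2).+1)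
    'C(j - j1 - j2 + t, t)%:R
    * G (nseq (j1 + a) true ++ false :: open_word c
         ++ true :: nseq (j - j1 - j2 + t) true).
Proof.
rewrite shuffle_sum_run_cat; apply: eq_bigr => j1 _.
by rewrite shuffle_sum_true_01.
Qed.

Lemma shuffle_sum_false_01 m n k G :
  shuffle_sum (nseq m false) (nseq n false ++ false :: nseq k true) G =
  \sum_(0 <= m1 < m.+1) 'C(m1 + n, n)%:R *
  \sum_(b <- compositions k.+1 (m - m1 + k).+1)
    G (nseq (m1 + n) false ++ false :: open_word b).
Proof.
rewrite shuffle_sum_run_cat; apply: eq_bigr => m1 _.
by rewrite shuffle_sum_false_true.
Qed.

Lemma shuffle_sum_false_010 m n k s G :
  shuffle_sum (nseq m false)
    (nseq n false ++ false :: nseq k true ++ false :: nseq s false) G =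
  \sum_(0 <= m1 < m.+1) 'C(m1 + n, n)%:R *
  \sum_(0 <= m2 < (m - m1).+1) \sum_(g <- compositions k.+1 (m2 + k).+1)
    'C(m - m1 - m2 + s, s)%:R *
    G (nseq (m1 + n) false ++ false :: open_word g
       ++ false :: nseq (m - m1 - m2 + s) false).
Proof.
rewrite shuffle_sum_run_cat; apply: eq_bigr => m1 _; congr (_ * _).
rewrite shuffle_sum_false_true_cat; apply: eq_bigr => m2 _.
by apply: eq_bigr => g _; rewrite shuffle_sum_run.
Qed.

Lemma shuffle_sum_false_0101 m n k s t G :
  shuffle_sum (nseq m false)
    (nseq n false ++ false :: nseq k true ++ true :: nseq s false
     ++ false :: nseq t true) G =
  \sum_(0 <= m1 < m.+1) 'C(m1 + n, n)%:R *
  \sum_(0 <= m2 < (m - m1).+1) \sum_(d <- compositions k.+1 (m2 + k).+1)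
  \sum_(0 <= m3 < (m - m1 - m2).+1) 'C(m3 + s, s)%:R *
  \sum_(d' <- compositions t.+1 (m - m1 - m2 - m3 + t).+1)
    G (nseq (m1 + n) false ++ false :: open_word d
       ++ true :: nseq (m3 + s) false ++ false :: open_word d').
Proof.
rewrite shuffle_sum_run_cat; apply: eq_bigr => m1 _; congr (_ * _).
rewrite shuffle_sum_false_true_cat; apply: eq_bigr => m2 _.
by apply: eq_bigr => d _; rewrite shuffle_sum_false_01.
Qed.

(** The cut falls in [v] or in [v']. A cut at the border is counted with [v], so the second range
    starts at 1; hence n_1 starts at 0 in the first sum, while k_1, s_1, t_1 start at 1. *)
Lemma big_nat_cat_cut (V : nmodType) (T : Type) d (v v' : seq T)
    (H : seq T -> seq T -> V) : (d <= (size v).+1)%N ->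
  \sum_(d <= i < (size (v ++ v')).+1) H (take i (v ++ v')) (drop i (v ++ v')) =
  \sum_(d <= i < (size v).+1) H (take i v) (drop i v ++ v')
  + \sum_(1 <= i < (size v').+1) H (v ++ take i v') (drop i v').
Proof.
move=> dv; rewrite size_cat (@big_cat_nat _ _ _ (size v).+1)//=; last by lia.
congr (_ + _).
  apply: eq_big_nat => i /andP[_ iv].
  rewrite takel_cat// drop_cat; move: iv; rewrite ltnS leq_eqVlt.
  by case/orP => [/eqP->|->//]; rewrite ltnn subnn drop0 drop_size.
rewrite -add1n big_addn.
rewrite (_ : (size v + size v').+1 - size v = (size v').+1)%N; last by lia.
apply: eq_bigr => i _.
by rewrite take_cat drop_cat ltnNge leq_addl/= addnK.
Qed.

End ShuffleOfRuns.

(** * The four sums *)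

Section Strings.
Implicit Types a b g d : seq nat.

(** The letters x_0 in front of an open word, the marked one included, join its first block; this
    gives the shifts [c.+1] and 1. *)
Lemma exponents_string1 l l' c p q a a' :
  size a = l.+1 -> all (leq 1) a -> size a' = l'.+1 -> all (leq 1) a' ->
  exponents 0 (nseq c false ++ false :: open_word a ++ true :: nseq p true
               ++ false :: open_word a' ++ true :: nseq q true)
  = add_at 0 c.+1 a ++ ones p ++ add_at 0 1 a' ++ ones q.
Proof.
move=> sa a1 sa' a1'; rewrite exponents_nseq_false/= add0n.
rewrite (exponents_open_word_true _ _ sa a1) exponents_nseq_true/=.
by rewrite (exponents_open_word_true _ _ sa' a1') exponents_ones.
Qed.

(** If j1 + k - k1 = 0, no x_1 separates the two open words, and the last block of [b] merges with
    the first block of [b']: this is the convention attached to the second sum. *)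
Lemma exponents_string2 l m1 n k k1 j1 q b b' :
  size b = k1.+1 -> all (leq 1) b -> size b' = l.+1 -> all (leq 1) b' ->
  exponents 0 (nseq (m1 + n) false ++ false :: open_word b ++ false ::
               nseq (j1 + k - k1) true ++ false :: open_word b'
               ++ true :: nseq q true)
  = Sigma2_string m1 n.+1 k k1 j1 b b' ++ ones q.
Proof.
move=> sb b1 sb' b1'; rewrite exponents_nseq_false/= add0n.
rewrite (exponents_open_word _ _ sb b1)/= /Sigma2_string addnS.
set A := add_at 0 _ b.
have sA := size_add_at0 _ sb : size A = _.
have A1 := nth_add_at0_gt0 _ sb b1 : (0 < nth 0 A _)%N.
case: (_ + k - _)%N => [|p] /=.
  rewrite (exponents_open_word_true _ _ sb' b1') exponents_ones prednK//.
  case: b' sb' {b1'} => // x b' _; rewrite add_at0 /Defs.glue -catA/=.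
  by congr (_ ++ _ :: _); lia.
rewrite exponents_nseq_true/= (exponents_open_word_true _ _ sb' b1').
rewrite exponents_ones (add_at_last _ sA) -!catA cat_rcons prednK// addn1 subn1.
by [].
Qed.

(** Only letters x_0 stand between the two open words, so the last block of [g], these [e.+2]
    letters and the first block of [g'] form one entry. *)
Lemma exponents_string3 l k c e q g g' :
  size g = k.+1 -> all (leq 1) g -> size g' = l.+1 -> all (leq 1) g' ->
  exponents 0 (nseq c false ++ false :: open_word g ++ false :: nseq e false
               ++ false :: open_word g' ++ true :: nseq q true)
  = Defs.glue k e.+1 (add_at 0 c.+1 g) g' ++ ones q.
Proof.
move=> sg g1 sg' g1'; rewrite exponents_nseq_false/= add0n.
rewrite (exponents_open_word _ _ sg g1)/= exponents_nseq_false/=.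
set A := add_at 0 _ g.
have sA := size_add_at0 _ sg : size A = _.
have A1 := nth_add_at0_gt0 _ sg g1 : (0 < nth 0 A _)%N.
rewrite (exponents_open_word_true _ _ sg' g1') exponents_ones prednK//.
case: g' sg' {g1'} => // x g' _; rewrite add_at0 /Defs.glue -catA/=.
by congr (_ ++ _ :: _); lia.
Qed.

(** The first of the [p.+1] final letters x_1 closes the last block of [d'], lengthened by the
    marked x_0; the others give the [p] ones. *)
Lemma exponents_string4 k t c e p d d' :
  size d = k.+1 -> all (leq 1) d -> size d' = t.+1 -> all (leq 1) d' ->
  exponents 0 (nseq c false ++ false :: open_word d ++ true :: nseq e false
               ++ false :: open_word d' ++ false :: nseq p.+1 true)
  = add_at 0 c.+1 d ++ add_at t 1 (add_at 0 e.+1 d') ++ ones p.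
Proof.
move=> sd d1 sd' d1'; rewrite exponents_nseq_false/= add0n.
rewrite (exponents_open_word_true _ _ sd d1) exponents_nseq_false/= add0n.
rewrite (exponents_open_word _ _ sd' d1')/= exponents_ones.
set A := add_at 0 _ d'.
have sA := size_add_at0 _ sd' : size A = _.
have A1 := nth_add_at0_gt0 _ sd' d1' : (0 < nth 0 A _)%N.
by rewrite (add_at_last _ sA) cat_rcons prednK// addn1.
Qed.

End Strings.

Lemma eq_big_seq_comp (V : nmodType) l w w' (G H : seq nat -> V) :
  w = w' ->
  (forall a, size a = l -> all (leq 1) a -> G a = H a) ->
  \sum_(a <- compositions l w) G a = \sum_(a <- compositions l w') H a.
Proof.
move=> <- eqGH; apply: eq_big_seq => a.
by rewrite mem_compositions => /and3P[/eqP sa a1 _]; exact: eqGH.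
Qed.

Lemma nseqS_cat (T : Type) i (x : T) w : nseq i.+1 x ++ w = nseq i x ++ x :: w.
Proof. by rewrite -addn1 nseqD -catA. Qed.

Section Sigmas.
Variable R : realType.
Implicit Types m n j k s t : nat.

Definition mzv_word (w : seq bool) : R := mzv R (exponents 0 w).

Let subS1 x : (x.+1 - 1)%N = x. Proof. by rewrite subn1. Qed.

(** In this lemma and the next three, the last x_0 of the first word is marked, [i] counts the
    letters of the run under consideration that precede it, and [w] and [w'] are the parts of the
    shuffle before and after it. *)
Lemma Sigma1_shuffle m n j k s t :
  Sigma1 R m.+1 n j k.+1 s.+1 t.+1 =
  \sum_(0 <= i < n.+1)
    shuffle_sum (nseq i false) (nseq m false) (fun w =>
      shuffle_sum (nseq (n - i) false ++ nseq k.+1 true ++ nseq s.+1 false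
                   ++ nseq t.+1 true) (nseq j true)
        (fun w' => mzv_word (w ++ false :: w'))).
Proof.
apply: eq_bigr => n1 _; rewrite big_nat_simplex4 shuffle_sum_run shuffle_sumC.
(* The first letter of each of these three runs is marked. *)
rewrite [nseq k.+1 true ++ _](_ : _ = true :: nseq k true ++ false ::
  nseq s false ++ true :: nseq t true)//.
rewrite shuffle_sum_true_false_cat big_distrr; apply: eq_bigr => j1 _ /=.
under [in RHS]eq_bigr => a _ do rewrite shuffle_sum_true_101.
rewrite exchange_big big_distrr/=.
under [in RHS]eq_bigr => a _ do rewrite big_distrr/=.
rewrite exchange_big/= [RHS]exchange_big/=; apply: eq_bigr => j2 _.
rewrite [LHS]exchange_big/=; apply: eq_big_seq_comp; [lia|] => a sa a1.
rewrite !big_distrr/=; apply: eq_bigr => j3 _; rewrite !big_distrr/=.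
apply: eq_big_seq_comp; [lia|] => a' sa' a1'.
rewrite /mzv_word (exponents_string1 _ _ _ sa a1 sa' a1').
rewrite !addnS !subS1 !natrM -!mulrA [(n1 + m)%N]addnC addSn.
by [].
Qed.

Lemma Sigma2_shuffle m n j k s t :
  Sigma2 R m.+1 n.+1 j k s.+1 t.+1 =
  \sum_(1 <= i < k.+1)
    shuffle_sum (nseq n.+1 false ++ nseq i true) (nseq m false) (fun w =>
      shuffle_sum (nseq (k - i) true ++ nseq s.+1 false
                   ++ nseq t.+1 true) (nseq j true)
        (fun w' => mzv_word (w ++ false :: w'))).
Proof.
apply: eq_big_nat => k1 /andP[k1_gt0 k1k].
rewrite nseqS_cat shuffle_sumC shuffle_sum_false_01.
apply: eq_big_nat => m1 /andP[_ m1m]; rewrite addnS !subS1; congr (_ * _).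
rewrite big_nat_simplex3.
under [in RHS]eq_bigr => b _.
  rewrite shuffle_sumC.
  rewrite [X in shuffle_sum _ X](_ : _ = nseq (k - k1) true ++ false ::
    nseq s false ++ true :: nseq t true)//.
  rewrite shuffle_sum_true_101.
  over.
rewrite [RHS]exchange_big/=; apply: eq_bigr => j1 _.
rewrite [LHS]exchange_big/= subSn// addSn; apply: eq_big_seq_comp; [lia|] => b sb b1.
rewrite big_distrr/=; apply: eq_bigr => j2 _; rewrite big_distrr/=.
apply: eq_big_seq_comp; [lia|] => b' sb' b1'.
rewrite addnBA// /mzv_word -catA cat_cons.
rewrite (exponents_string2 _ _ _ _ _ sb b1 sb' b1').
by rewrite !addnS !subS1 !natrM -!mulrA.
Qed.

Lemma Sigma3_shuffle m n j k s t :
  Sigma3 R m.+1 n.+1 j k s t.+1 =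
  \sum_(1 <= i < s.+1)
    shuffle_sum (nseq n.+1 false ++ nseq k true ++ nseq i false)
      (nseq m false) (fun w =>
      shuffle_sum (nseq (s - i) false ++ nseq t.+1 true) (nseq j true)
        (fun w' => mzv_word (w ++ false :: w'))).
Proof.
(* As [i] is positive, the run x_0^i has a first letter that can be marked. *)
apply: eq_big_nat => -[//|s1] _; rewrite !subS1 big_nat_simplex3.
rewrite nseqS_cat shuffle_sumC.
rewrite [X in shuffle_sum _ X](_ : _ = nseq n false ++ false :: nseq k true ++
  false :: nseq s1 false)//.
rewrite shuffle_sum_false_010; apply: eq_bigr => m1 _.
rewrite [RHS]big_distrr/=; apply: eq_bigr => m2 _.
rewrite big_nat_simplex2 [in LHS]addnS [in LHS]addnS !subS1 natrM -mulrA.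
congr (_ * _); under [in RHS]eq_bigr => g _.
  rewrite shuffle_sumC.
  rewrite shuffle_sum_true_01 big_distrr/=.
  over.
rewrite [RHS]exchange_big/= big_distrr/=; apply: eq_bigr => j1 _.
rewrite big_distrr/=; apply: eq_big_seq_comp; [lia|] => g sg g1.
rewrite !big_distrr/=; apply: eq_big_seq_comp; [lia|] => g' sg' g1'.
rewrite /mzv_word -catA cat_cons -catA cat_cons.
rewrite (exponents_string3 _ _ _ sg g1 sg' g1').
by rewrite !addnS !subS1.
Qed.

Lemma Sigma4_shuffle m n j k s t :
  Sigma4 R m.+1 n.+1 j.+1 k.+1 s.+1 t =
  \sum_(1 <= i < t.+1)
    shuffle_sum (nseq n.+1 false ++ nseq k.+1 true ++ nseq s.+1 false
                 ++ nseq i true)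
      (nseq m false) (fun w =>
      shuffle_sum (nseq (t - i) true) (nseq j.+1 true)
        (fun w' => mzv_word (w ++ false :: w'))).
Proof.
apply: eq_big_nat => t1 /andP[_ t1t]; rewrite !subS1 big_nat_simplex4.
rewrite nseqS_cat shuffle_sumC [nseq k.+1 true ++ _]nseqS_cat.
rewrite [nseq s.+1 false ++ _]nseqS_cat.
rewrite shuffle_sum_false_0101; apply: eq_bigr => m1 _.
rewrite [RHS]big_distrr/=; apply: eq_bigr => m2 _.
rewrite [in RHS]exchange_big/= [RHS]big_distrr/=; apply: eq_bigr => m3 _.
rewrite !big_distrr/=; apply: eq_big_seq_comp; [lia|] => d sd d1.
rewrite !big_distrr/=; apply: eq_big_seq_comp; [lia|] => d' sd' d1'.
rewrite -[true :: nseq j true]/(nseq j.+1 true) shuffle_sum_run /mzv_word.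
rewrite -catA cat_cons -catA cat_cons -catA cat_cons.
(* The number of final letters x_1 is positive: one of them closes the last entry. *)
rewrite (_ : (t - t1 + j.+1)%N = (j + t - t1).+1); last by lia.
rewrite (exponents_string4 _ _ _ sd d1 sd' d1').
rewrite (_ : (j.+1 + t - t1)%N = (j + t - t1).+1); last by lia.
by rewrite !addnS !subS1 !natrM -!mulrA.
Qed.

Lemma shuffle_sum_mzv_word m n j k s t :
  (0 < m)%N -> (0 < n)%N -> (0 < j)%N -> (0 < k)%N -> (0 < s)%N -> (0 < t)%N ->
  shuffle_sum (nseq n false ++ nseq k true ++ nseq s false ++ nseq t true)
    (nseq m false ++ nseq j true) mzv_word
  = Sigma1 R m n j k s t + Sigma2 R m n j k s t
    + Sigma3 R m n j k s t + Sigma4 R m n j k s t.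
Proof.
case: m n j k s t => [//|m] [//|n] [//|j] [//|k] [//|s] [//|t] _ _ _ _ _ _.
rewrite Sigma1_shuffle Sigma2_shuffle Sigma3_shuffle Sigma4_shuffle.
rewrite [nseq m.+1 _ ++ _]nseqS_cat shuffle_sum_cat_cons.
(* [H v v'] collects the shuffles in which the marked x_0 cuts the other word into [v] and [v']. The
   three splittings below locate the cut in one of the four runs. *)
pose H v v' := shuffle_sum v (nseq m false) (fun w =>
  shuffle_sum v' (nseq j.+1 true) (fun w' => mzv_word (w ++ false :: w'))).
rewrite (big_nat_cat_cut _ H)//.
rewrite (big_nat_cat_cut _ (fun v => H (nseq n.+1 false ++ v)))//.
rewrite (big_nat_cat_cut _
  (fun v => H (nseq n.+1 false ++ nseq k.+1 true ++ v)))//.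
rewrite !addrA !size_nseq /H.
by congr (_ + _ + _ + _); apply: eq_big_nat => i /andP[_ il];
  rewrite take_nseq ?drop_nseq.
Qed.

End Sigmas.

(** * Coefficients of multiple polylogarithms *)

Section Coefficients.
Variable R : realType.
Implicit Types (f g : nat -> R) (u v w : seq bool) (s : seq nat).

(** The bound is strict, as in n_1 > n_2 > ...: these are the coefficients of the series of [f]
    multiplied by z/(1-z). *)
Definition partial_sum f (N : nat) : R := \sum_(0 <= M < N) f M.

(* Coefficient of z^N in the multiple polylogarithm of w. *)
Fixpoint word_coef w (N : nat) : R :=
  match w with
  | [::] => (N == 0%N)%:R
  | x :: w' => (if x then partial_sum (word_coef w') N else word_coef w' N) / N%:R
  end.

(* The part of the series of s with largest index N. *)
Fixpoint mzv_coef s (N : nat) : R :=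
  match s with
  | [::] => (N == 0%N)%:R
  | a :: s' => N%:R ^- a * partial_sum (mzv_coef s') N
  end.

Lemma eq_partial_sum f g : f =1 g -> partial_sum f =1 partial_sum g.
Proof. by move=> fg N; apply: eq_bigr. Qed.

(** Each pending x_0 stands for a division by N. The hypothesis says that [w] ends in x_1, or is
    empty with nothing pending. *)
Lemma word_coef_exponents c w N : last (c == 0%N) w ->
  word_coef w N / N%:R ^+ c = mzv_coef (exponents c w) N.
Proof.
elim: w c N => [|x w IHw] c N.
  by move=> /eqP->; rewrite expr0 divr1.
have word_coefE : word_coef (x :: w) N / N%:R ^+ c =
    (if x then partial_sum (word_coef w) N else word_coef w N) / N%:R ^+ c.+1.
  by rewrite exprS invfM mulrA.
rewrite {}word_coefE; case: x => lw; last exact: IHw.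
have -> : partial_sum (word_coef w) N = partial_sum (mzv_coef (exponents 0 w)) N.
  by apply: eq_partial_sum => M; rewrite -IHw// expr0 divr1.
by rewrite mulrC.
Qed.

Lemma word_coef_ge0 w N : 0 <= word_coef w N.
Proof.
elim: w N => [|[] w IHw] N /=; first exact: ler0n.
- by rewrite divr_ge0// sumr_ge0.
- by rewrite divr_ge0.
Qed.

(** Division by 0 returns 0, which is the correct constant coefficient for a word ending in x_1. *)
Lemma word_coef0 w : w != [::] -> word_coef w 0 = 0.
Proof. by case: w => //= x w _; rewrite invr0 mulr0. Qed.

Definition convolution f g (N : nat) : R :=
  \sum_(0 <= i < N.+1) f i * g (N - i)%N.

Lemma eq_convolution f f' g g' : f =1 f' -> g =1 g' ->
  convolution f g =1 convolution f' g'.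
Proof. by move=> ff' gg' N; apply: eq_bigr => i _; rewrite ff' gg'. Qed.

Lemma convolutionC f g N : convolution f g N = convolution g f N.
Proof.
rewrite /convolution big_nat_rev; apply: eq_big_nat => i /andP[_ iN].
by rewrite add0n subSS subKn// mulrC.
Qed.

Lemma convolution1 g N : convolution (word_coef [::]) g N = g N.
Proof.
rewrite /convolution big_nat_recl//= mul1r subn0 big1 ?addr0// => i _.
by rewrite mul0r.
Qed.

Lemma partial_sumS f N : partial_sum f N.+1 = partial_sum f N + f N.
Proof. by rewrite /partial_sum big_nat_recr. Qed.

Lemma partial_sum0 f : partial_sum f 0 = 0.
Proof. by rewrite /partial_sum big_geq. Qed.

(** Multiplication by z/(1-z) can be carried out on one factor of a product. *)
Lemma convolution_partial_sum f g N :
  convolution (partial_sum f) g N = partial_sum (convolution f g) N.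
Proof.
elim: N => [|N IHN].
  by rewrite /convolution big_nat1 !partial_sum0 mul0r.
rewrite partial_sumS -IHN /convolution big_nat_recl// partial_sum0 mul0r add0r.
by rewrite -big_split; apply: eq_bigr => i _; rewrite partial_sumS mulrDl subSS.
Qed.

(* Multiplication by N is the derivation z d/dz of power series. *)
Lemma convolution_leibniz f g N :
  N%:R * convolution f g N =
  convolution (fun i => i%:R * f i) g N + convolution f (fun i => i%:R * g i) N.
Proof.
rewrite big_distrr -big_split; apply: eq_big_nat => i /andP[_ iN] /=.
have -> : N%:R = i%:R + (N - i)%:R :> R by rewrite -natrD subnKC.
by ring.
Qed.

Definition letter_op (x : bool) f : nat -> R := if x then partial_sum f else f.

(** This is the action of z d/dz on the first letter. The hypothesis excludes the one-letter word
    x_0, for which the two sides at N = 0 are 0 and 1. *)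
Lemma letter_op_word_coef x w N : last true (x :: w) ->
  N%:R * word_coef (x :: w) N = letter_op x (word_coef w) N.
Proof.
case: N => [|N] /= lxw; last by rewrite mulrC divfK ?pnatr_eq0//; case: x lxw.
rewrite mul0r; case: x lxw => /= lw; first by rewrite partial_sum0.
by rewrite word_coef0//; case: w lw.
Qed.

Lemma convolution_letter_op x f g N :
  convolution (letter_op x f) g N = letter_op x (convolution f g) N.
Proof. by case: x => //=; exact: convolution_partial_sum. Qed.

Lemma last_cons_true x u : last true (x :: u) -> last true u.
Proof. by case: u. Qed.

Lemma shuffle_sum_letter_op x u v (F : seq bool -> nat -> R) N :
  letter_op x (fun M => shuffle_sum u v (fun w => F w M)) N =
  shuffle_sum u v (fun w => letter_op x (F w) N).
Proof.
case: x => //=; elim: N => [|N IHN].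
  rewrite partial_sum0 (@eq_shuffle_sum _ _ _ _ _ (fun=> 0)).
    elim: u v => [|x u IHu] v; first by rewrite shuffle_sum0s.
    elim: v => [|y v IHv]; first by rewrite shuffle_sums0.
    by rewrite shuffle_sum_cons -IHu -IHv addr0.
  by move=> w; rewrite partial_sum0.
rewrite partial_sumS IHN -shuffle_sumD; apply: eq_shuffle_sum => w.
by rewrite partial_sumS.
Qed.

Lemma shuffle_sum_mulrr u v (F : seq bool -> R) c :
  shuffle_sum u v F * c = shuffle_sum u v (fun w => F w * c).
Proof.
elim: u v F => [|x u IHu] v F; first by rewrite !shuffle_sum0s.
elim: v F => [|y v IHv] F; first by rewrite !shuffle_sums0.
by rewrite !shuffle_sum_cons mulrDl IHu IHv.
Qed.

(** After multiplication by N, the Leibniz rule becomes the recursion of shuffles: differentiating a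
    factor removes its first letter, which is then the first letter of the shuffle. *)
Lemma convolution_word_coef u v N : last true u -> last true v ->
  convolution (word_coef u) (word_coef v) N =
  shuffle_sum u v (fun w => word_coef w N).
Proof.
elim: u v N => [|x u IHu] v N lu lv.
  by rewrite convolution1 shuffle_sum0s.
elim: v N lv => [|y v IHv] N lv.
  by rewrite convolutionC convolution1 shuffle_sums0.
(* The factor N cannot be cancelled at N = 0; there both sides vanish, since both words are
   nonempty. *)
have [->|N0] := eqVneq N 0%N.
  rewrite /convolution big_nat1 word_coef0// mul0r.
  rewrite shuffle_sum_cons.
  (* Writing 0 as 0 * 0 lets [shuffle_sum_mulrr] pull a factor 0 out of the sum. *)
  rewrite !(@eq_shuffle_sum _ _ _ _ _ (fun=> 0 * 0)) -?shuffle_sum_mulrr ?mulr0 ?addr0//.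
  by move=> w; rewrite word_coef0 ?mulr0.
  by move=> w; rewrite word_coef0 ?mulr0.
have NR0 : N%:R != 0 :> R by rewrite pnatr_eq0.
apply: (mulfI NR0); rewrite convolution_leibniz.
rewrite (eq_convolution (fun i => letter_op_word_coef i lu) (frefl _)).
rewrite (eq_convolution (frefl _) (fun i => letter_op_word_coef i lv)).
rewrite [X in _ + X]convolutionC !convolution_letter_op shuffle_sum_cons mulrDr.
rewrite ![N%:R * _]mulrC !shuffle_sum_mulrr.
have L z w : word_coef (z :: w) N * N%:R = letter_op z (word_coef w) N.
  by rewrite /= divfK//; case: z.
have E z f g : f =1 g -> letter_op z f =1 letter_op z g.
  by case: z => //; exact: eq_partial_sum.
congr (_ + _).
  rewrite (E _ _ _ (fun M => IHu _ M (last_cons_true lu) lv)).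
  rewrite shuffle_sum_letter_op; apply: eq_shuffle_sum => w.
  exact/esym/L.
rewrite (E _ _ _ (fun M => etrans (convolutionC _ _ _) (IHv M (last_cons_true lv)))).
rewrite shuffle_sum_letter_op; apply: eq_shuffle_sum => w.
exact/esym/L.
Qed.

End Coefficients.

(** * Convergence *)

Section SeriesOfMZV.
Variable R : realType.
Implicit Types (f g : nat -> R) (s u : seq nat).

Definition mzv_term s u : R :=
  \prod_(i < size s) ((nth 0%N u i)%:R ^- nth 0%N s i).

(** These finite lists exhaust [mzv_index r] as K grows, and their recursion is that of
    [mzv_coef]. *)
Fixpoint mzv_index_lt (r K : nat) : seq (seq nat) :=
  match r with
  | 0%N => [:: [::]]
  | r'.+1 => [seq N :: u | N <- index_iota 1 K, u <- mzv_index_lt r' N]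
  end.

Lemma mem_mzv_index_lt r K u :
  (u \in mzv_index_lt r K) =
  [&& size u == r, path (fun a b => (b < a)%N) K u & all (leq 1) u].
Proof.
elim: r K u => [|r IHr] K u; first by rewrite inE; case: u.
apply/allpairsPdep/idP => [[N [v [+ + ->]]]|].
  rewrite mem_index_iota IHr => /andP[N1 NK] /and3P[/eqP<- pv v1].
  by rewrite /= eqxx NK pv N1.
case: u => [//|N u] /and3P[/= sv /andP[NK pu] /andP[N1 u1]].
by exists N, u; rewrite mem_index_iota N1 NK IHr pu u1 -eqSS sv.
Qed.

Lemma mzv_index_lt_uniq r K : uniq (mzv_index_lt r K).
Proof.
elim: r K => [//|r IHr] K; apply: allpairs_uniq_dep => //.
  exact: iota_uniq.
by move=> [i a] [i' a'] _ _ [/= -> ->].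
Qed.

(** The bound is [K.+1] because for empty [s] and bound 0 the left side would be 1 and the right
    side 0. *)
Lemma sum_mzv_index_lt s K :
  \sum_(u <- mzv_index_lt (size s) K.+1) mzv_term s u =
  partial_sum (mzv_coef R s) K.+1.
Proof.
elim: s K => [|a s IHs] K.
  rewrite big_seq1 /mzv_term big_ord0 /partial_sum big_nat_recl//=.
  by rewrite big1 ?addr0.
rewrite [LHS]big_allpairs_dep /partial_sum [RHS]big_ltn//.
rewrite -[mzv_coef R (a :: s) 0]/(0%:R ^- a * partial_sum (mzv_coef R s) 0).
rewrite partial_sum0 mulr0 add0r; apply: eq_big_nat => -[//|N] _.
rewrite -[RHS]/(N.+1%:R ^- a * partial_sum (mzv_coef R s) N.+1) -IHs big_distrr.
by apply: eq_bigr => u _; rewrite /mzv_term big_ord_recl.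
Qed.

Lemma mzv_term_ge0 s u : 0 <= mzv_term s u.
Proof. by apply: prodr_ge0 => i _; rewrite invr_ge0 exprn_ge0. Qed.

Lemma partial_sum_nondecreasing f : (forall N, 0 <= f N) ->
  nondecreasing_seq (partial_sum f).
Proof.
move=> f0; apply/nondecreasing_seqP => N.
by rewrite partial_sumS lerDl.
Qed.

Lemma mzv_coef_ge0 s N : 0 <= mzv_coef R s N.
Proof.
elim: s N => [|a s IHs] N; first exact: ler0n.
by rewrite mulr_ge0 ?invr_ge0 ?exprn_ge0 ?sumr_ge0.
Qed.

(** The terms are nonnegative, so the sum over all index tuples is the supremum of its finite
    subsums, and each finite set of tuples lies in some [mzv_index_lt]. *)
Lemma cvg_partial_sum_mzv s l :
  (partial_sum (mzv_coef R s) @ \oo --> l)%classic -> mzv R s = l.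
Proof.
move=> sl.
have nd := partial_sum_nondecreasing (mzv_coef_ge0 s).
have le_l K : partial_sum (mzv_coef R s) K <= l.
  by rewrite -(cvg_lim _ sl)//; apply: nondecreasing_cvgn_le => //; apply: cvgP sl.
have sumE K : (\sum_(u \in [set` mzv_index_lt (size s) K.+1]%classic)
    (mzv_term s u)%:E)%E = (partial_sum (mzv_coef R s) K.+1)%:E.
  by rewrite -fsbig_seq ?mzv_index_lt_uniq// sumEFin sum_mzv_index_lt.
rewrite /mzv -/(mzv_term s _) (_ : esum _ _ = l%:E)//.
apply/eqP; rewrite eq_le; apply/andP; split.
  apply: ge_ereal_sup => _ [A [Afin Asub] <-].
  have [r Ar] := (finite_seqP A).1 Afin.
  (* The entries decrease, so bounding the first one bounds them all. *)
  pose K := \max_(u <- r) head 0%N u.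
  apply: (@le_trans _ _ (partial_sum (mzv_coef R s) K.+1)%:E); last first.
    by rewrite lee_fin.
  rewrite -sumE; apply: lee_fsum_nneg_subset => //.
  - exact: finite_seq.
  - move=> u; rewrite !inE => Au; have [su srt u1] := Asub _ Au.
    rewrite /= mem_mzv_index_lt su eqxx u1 andbT/=.
    have : (head 0 u <= K)%N.
      by apply: leq_bigmax_seq => //; rewrite Ar in Au.
    by case: u {su u1 Au} srt => //= N u ->; rewrite andbT.
  - by move=> u _; rewrite lee_fin mzv_term_ge0.
have le_esum K : ((partial_sum (mzv_coef R s) K)%:E <=
    \esum_(u in mzv_index (size s)) (mzv_term s u)%:E)%E.
  apply: (@le_trans _ _ (partial_sum (mzv_coef R s) K.+1)%:E).
    by rewrite lee_fin nd.
  rewrite -sumE; apply: esum_ge; exists [set` mzv_index_lt (size s) K.+1]%classic => //.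
  split=> [|u]; first exact: finite_seq.
  rewrite /= mem_mzv_index_lt => /and3P[/eqP su /path_sorted srt u1].
  by split.
move: le_esum; case: (esum _ _) => [x|//|/(_ 0%N)//] le_x; last by rewrite leey.
rewrite lee_fin; apply: (cvgr_to_le sl).
by apply: nearW => K; have := le_x K; rewrite lee_fin.
Qed.

End SeriesOfMZV.

(** * Convergence of word series and the product formula *)

Section Convergence.
Variable R : realType.
Implicit Types (f g : nat -> R) (u v w : seq bool).

(* For M > 0 the sum of 1/N^2 over N > M telescopes to at most 1/M. *)
Lemma partial_sum_div_sqr f K : (forall N, 0 <= f N) ->
  partial_sum (fun N => partial_sum f N / N%:R / N%:R) K
  <= 2 * f 0%N + partial_sum (fun N => f N / N%:R) K.
Proof.
move=> f0; have psum_ge0 g N : (forall i, 0 <= g i) -> 0 <= partial_sum g N.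
  by move=> g0; exact: sumr_ge0.
case: K => [|L]; first by rewrite !partial_sum0 addr0 mulr_ge0.
(* The added term bounds what the coefficients up to index L still contribute for N > L; with it the
   inequality can be proved by induction on L. *)
apply: (@le_trans _ _ (partial_sum (fun N => partial_sum f N / N%:R / N%:R) L.+1
    + partial_sum f L.+1 / L%:R)).
  by rewrite lerDl divr_ge0// psum_ge0.
elim: L => [|L IHL].
  by rewrite !partial_sumS !partial_sum0 invr0 !mulr0 !addr0 mulr_ge0.
(* The factor 2 arises at L = 1: [f 0] counts once for N = 1 and once for the bound on N > 1. *)
case: L IHL => [_|L IHL].
  rewrite !partial_sumS !partial_sum0 invr0 invr1 !mulr0 !mulr1 !add0r.
  by lra.
have P0 := psum_ge0 _ L.+2 f0.
rewrite partial_sumS [partial_sum f L.+3]partial_sumS.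
rewrite [X in _ <= _ + X]partial_sumS.
have x0 : 0 < L.+1%:R :> R by rewrite ltr0n.
rewrite -[L.+2%:R]natr1; move: (L.+1%:R) x0 P0 IHL => x x0.
move: (partial_sum f L.+2) (partial_sum (fun N => f N / N%:R) L.+2) => P T.
move: (partial_sum _ L.+2) => S P0 IHL.
have : P / (x + 1) / (x + 1) + P / (x + 1) <= P / x.
  have x1 : 0 < x + 1 by rewrite addr_gt0.
  have -> : P / x = P / (x + 1) / (x + 1) + P / (x + 1)
      + P / (x * (x + 1) ^+ 2).
    by field; rewrite !gt_eqF.
  by rewrite lerDl divr_ge0// mulr_ge0 ?exprn_ge0// ltW.
by rewrite mulrDl; lra.
Qed.

Lemma last_cons_false x w : last false w -> last false (x :: w).
Proof. by case: w. Qed.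

(** The hypothesis makes [w] nonempty with last letter x_1. Deleting its first letter, as long as
    another remains, does not decrease the partial sums: an x_0 only divides by N, and an x_1 is
    handled by [partial_sum_div_sqr]. There remains x_0 x_1, that is, zeta(2), bounded by 2. *)
Lemma partial_sum_word_coef_le2 w K : last false w ->
  partial_sum (word_coef R (false :: w)) K <= 2.
Proof.
elim: w K => [//|[] w IHw] K lw; last first.
  apply: le_trans (IHw K _); last by case: w lw {IHw}.
  apply: ler_sum => -[|N] _; first by rewrite /= invr0 !mulr0.
  rewrite -[leLHS]/(word_coef R (false :: w) N.+1 / N.+1%:R).
  by rewrite ler_pdivrMr ?ltr0n// ler_peMr ?word_coef_ge0 ?ler1n.
rewrite -[leLHS]/(partial_sum
  (fun N => partial_sum (word_coef R w) N / N%:R / N%:R) K).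
apply: le_trans (partial_sum_div_sqr K (@word_coef_ge0 R w)) _.
case: w lw IHw => [_ _|x w lw IHw].
  rewrite /= mulr1 gerDl /partial_sum big1// => -[|N] _ /=.
    by rewrite invr0 mulr0.
  by rewrite mul0r.
by rewrite word_coef0// mulr0 add0r; exact: IHw.
Qed.

Lemma cvg_partial_sum_word w : last false w ->
  (partial_sum (word_coef R (false :: w)) @ \oo
    --> mzv_word R (false :: w))%classic.
Proof.
move=> lw; set u := partial_sum _.
have cu : cvgn u.
  apply: nondecreasing_is_cvgn.
    exact/partial_sum_nondecreasing/word_coef_ge0.
  by exists 2 => _ [K _ <-]; exact: partial_sum_word_coef_le2.
rewrite /mzv_word (@cvg_partial_sum_mzv _ _ (limn u)) //.
rewrite (_ : partial_sum _ = u)//; apply/funext => K.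
apply: eq_partial_sum => N.
by rewrite -word_coef_exponents ?expr0 ?divr1//; case: w lw {u cu}.
Qed.

(** The K-th partial sum of the product runs over the triangle i + j < K. The square of side K
    contains this triangle and is contained in the triangle of side 2K. *)
Lemma cvg_convolution f g (a b : R) :
  (forall N, 0 <= f N) -> (forall N, 0 <= g N) ->
  (partial_sum f @ \oo --> a)%classic -> (partial_sum g @ \oo --> b)%classic ->
  (partial_sum (convolution f g) @ \oo --> a * b)%classic.
Proof.
move=> f0 g0 fa gb; set c := partial_sum _.
have ndf := partial_sum_nondecreasing f0.
have ndg := partial_sum_nondecreasing g0.
have pf0 K : 0 <= partial_sum f K by exact: sumr_ge0.
have pg0 K : 0 <= partial_sum g K by exact: sumr_ge0.
have cE K : c K = \sum_(0 <= i < K) f i * partial_sum g (K - i).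
  rewrite /c (eq_partial_sum (convolutionC f g)) -convolution_partial_sum.
  rewrite convolutionC /convolution big_nat_recr//=.
  by rewrite subnn partial_sum0 mulr0 addr0.
have c_le K : c K <= partial_sum f K * partial_sum g K.
  rewrite cE mulr_suml; apply: ler_sum => i _.
  by apply: ler_wpM2l => //; apply: ndg; exact: leq_subr.
have c_ge K : partial_sum f K * partial_sum g K <= c (K + K)%N.
  rewrite cE (@big_cat_nat _ _ _ K) ?leq_addr//= mulr_suml.
  rewrite -[leLHS]addr0 lerD// ?sumr_ge0// => [|i _]; last exact: mulr_ge0.
  apply: ler_sum_nat => i /andP[_ iK]; apply: ler_wpM2l => //.
  have KK : (K <= K + K - i)%N by rewrite -addnBA ?leq_addr// ltnW.
  exact: ndg KK.
have ab : ((fun K => partial_sum f K * partial_sum g K) @ \oo --> a * b)%classic.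
  exact: cvgM fa gb.
have c_ab K : c K <= a * b.
  apply: le_trans (c_le K) _; apply: cvgr_to_ge ab _.
  near=> N; apply: ler_pM => //; [apply: ndf|apply: ndg];
    by near: N; exact: nbhs_infty_ge.
have ndc : nondecreasing_seq c.
  apply: partial_sum_nondecreasing => N.
  by rewrite sumr_ge0// => i _; rewrite mulr_ge0.
have cc : cvgn c.
  by apply: nondecreasing_is_cvgn => //; exists (a * b) => _ [K _ <-].
have -> : a * b = limn c; last exact: cc.
apply/eqP; rewrite eq_le; apply/andP; split.
  apply: cvgr_to_le ab _; apply: nearW => K; apply: le_trans (c_ge K) _.
  exact: nondecreasing_cvgn_le.
by apply: limr_le => //; exact: nearW.
Unshelve. all: by end_near. Qed.

(** Every shuffle of [u] and [v] is nonempty and ends in x_1, so the assumed convergence applies to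
    each summand. *)
Lemma cvg_shuffle_sum (F : seq bool -> nat -> R) (L : seq bool -> R) u v :
  (forall w, last false w -> (F w @ \oo --> L w)%classic) ->
  last true u -> last true v -> u ++ v != [::] ->
  ((fun K => shuffle_sum u v (F ^~ K)) @ \oo --> shuffle_sum u v L)%classic.
Proof.
elim: u v F L => [|x u IHu] v F L FL lu lv uv.
  rewrite shuffle_sum0s; under eq_fun do rewrite shuffle_sum0s.
  by apply: FL; case: v lv uv.
elim: v F L FL lv uv => [|y v IHv] F L FL lv uv.
  rewrite shuffle_sums0; under eq_fun do rewrite shuffle_sums0.
  exact: FL.
rewrite shuffle_sum_cons; under eq_fun do rewrite shuffle_sum_cons.
apply: cvgD.
  apply: (IHu _ (fun w => F (x :: w))) => //; last by case: (u).
    by move=> w lw; exact/FL/last_cons_false.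
  exact: last_cons_true lu.
apply: (IHv (fun w => F (y :: w))) => //.
  by move=> w lw; exact/FL/last_cons_false.
exact: last_cons_true lv.
Qed.

Lemma mzv_word_mul u v : last false u -> last false v ->
  mzv_word R (false :: u) * mzv_word R (false :: v) =
  shuffle_sum (false :: u) (false :: v) (mzv_word R).
Proof.
move=> lu lv; have lt w : last false w -> last true w by case: w.
have := cvg_convolution (@word_coef_ge0 R (false :: u))
  (@word_coef_ge0 R (false :: v)) (cvg_partial_sum_word lu)
  (cvg_partial_sum_word lv).
move=> /cvg_lim <-//; apply: cvg_lim => //.
have E K : partial_sum (convolution (word_coef R (false :: u))
      (word_coef R (false :: v))) K =
    shuffle_sum (false :: u) (false :: v) (fun w => partial_sum (word_coef R w) K).
  rewrite -(shuffle_sum_letter_op true); apply: eq_partial_sum => N.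
  by rewrite [LHS]convolution_word_coef ?lt.
rewrite (_ : partial_sum _ = (fun K => shuffle_sum (false :: u) (false :: v)
   (fun w => partial_sum (word_coef R w) K))); last exact/funext.
(* Convergence needs a leading x_0. Both words begin with one, so one step of the recursion exhibits
   it in every shuffle. *)
rewrite shuffle_sum_cons; under eq_fun do rewrite shuffle_sum_cons.
apply: cvgD.
  apply: (@cvg_shuffle_sum (fun w => partial_sum (word_coef R (false :: w)))
    (fun w => mzv_word R (false :: w))) => //.
  - by move=> w; exact: cvg_partial_sum_word.
  - exact: lt.
  - by case: (u).
apply: (@cvg_shuffle_sum (fun w => partial_sum (word_coef R (false :: w)))
    (fun w => mzv_word R (false :: w))) => //.
- by move=> w; exact: cvg_partial_sum_word.
- exact: lt.
Qed.

End Convergence.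

Theorem theorem1p3 (R : realType) (m n j k s t : nat)
  (hm : (0 < m)%N) (hn : (0 < n)%N) (hj : (0 < j)%N)
  (hk : (0 < k)%N) (hs : (0 < s)%N) (ht : (0 < t)%N) :
  mzv R ((m + 1)%N :: ones (j - 1))
  * mzv R ((n + 1)%N :: ones (k - 1) ++ (s + 1)%N :: ones (t - 1))
  = Sigma1 R m n j k s t + Sigma2 R m n j k s t
    + Sigma3 R m n j k s t + Sigma4 R m n j k s t.
Proof.
rewrite -shuffle_sum_mzv_word//.
have -> : mzv R ((m + 1)%N :: ones (j - 1)) =
    mzv_word R (nseq m false ++ nseq j true).
  case: j hj => // j _; rewrite /mzv_word exponents_nseq_false/= exponents_ones.
  by rewrite subn1 addn1.
have -> : mzv R ((n + 1)%N :: ones (k - 1) ++ (s + 1)%N :: ones (t - 1)) =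
    mzv_word R (nseq n false ++ nseq k true ++ nseq s false ++ nseq t true).
  case: k hk t ht => // k _ [//|t] _; rewrite /mzv_word exponents_nseq_false/=.
  rewrite exponents_nseq_true exponents_nseq_false/= exponents_ones.
  by rewrite !subn1 !addn1.
(* In [shuffle_sum_mzv_word] the word with the marked letter comes second. *)
rewrite mulrC; case: m n j t hm hn hj ht => [//|m] [//|n] [//|j] [//|t] _ _ _ _.
have last_ones x i : last x (nseq i.+1 true) by elim: i x => // i IHi x; exact: IHi true.
by rewrite mzv_word_mul// !last_cat.
Qed.
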